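(* For every positive integer $m$, $$A_{2m}^+(s,t)=s A_{2m-1}^+(s,t)+tA_{2m-1}^-(s,t)+\tfrac12 st\,D A_{2m-1}(s,t),$$ $$A_{2m}^-(s,t)=s A_{2m-1}^-(s,t)+tA_{2m-1}^+(s,t)+\tfrac12 st\,D A_{2m-1}(s,t),$$ where $D=\frac{\partial}{\partial s}+\frac{\partial}{\partial t}$.
   Context: For a permutation $\pi=\pi_1\cdots\pi_n$ of $[n]$ let $\mathsf{des}(\pi)=|\{i\in[n-1]:\pi_i>\pi_{i+1}\}|$ and $\mathsf{asc}(\pi)=n-1-\mathsf{des}(\pi)$. Let $\mathfrak{S}_n$ be the symmetric group and $\mathcal{A}_n$ the alternating group. $A_n(s,t)=\sum_{\pi\in\mathfrak{S}_n}t^{\mathsf{des}(\pi)}s^{\mathsf{asc}(\pi)}$, $A_n^+(s,t)=\sum_{\pi\in\mathcal{A}_n}t^{\mathsf{des}(\pi)}s^{\mathsf{asc}(\pi)}$ and $A_n^-(s,t)=\sum_{\pi\in\mathfrak{S}_n\setminus\mathcal{A}_n}t^{\mathsf{des}(\pi)}s^{\mathsf{asc}(\pi)}$. *)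

(* Defs.v *)
From mathcomp Require Import all_boot all_order all_algebra all_fingroup all_solvable.
From mathcomp.multinomials Require Import mpoly.

Set Implicit Arguments.
Unset Strict Implicit.
Unset Printing Implicit Defensive.

Import GRing.Theory.
Local Open Scope ring_scope.

(* A permutation is p : 'S_n, a bijection of {0, .., n-1}, in place of [n];
   shifting positions and values by 1 changes neither descents nor parity. *)

Definition des (n : nat) (p : 'S_n) : nat :=
  #|[set i : 'I_n | [exists j : 'I_n, (j == i.+1 :> nat) && (p j < p i)%N]]|.

Definition asc (n : nat) (p : 'S_n) : nat := (n - 1 - des p)%N.

Definition var_s : {mpoly rat[2]} := 'X_(0 : 'I_2).
Definition var_t : {mpoly rat[2]} := 'X_(1 : 'I_2).

Definition eulerian (n : nat) : {mpoly rat[2]} :=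
  \sum_(p : 'S_n) var_t ^+ des p * var_s ^+ asc p.

Definition eulerian_even (n : nat) : {mpoly rat[2]} :=
  \sum_(p : 'S_n | p \in Alt 'I_n) var_t ^+ des p * var_s ^+ asc p.

Definition eulerian_odd (n : nat) : {mpoly rat[2]} :=
  \sum_(p : 'S_n | p \notin Alt 'I_n) var_t ^+ des p * var_s ^+ asc p.

Definition Dst (f : {mpoly rat[2]}) : {mpoly rat[2]} :=
  mderiv (0 : 'I_2) f + mderiv (1 : 'I_2) f.

(* Main.v *)
Require Import Defs.
From mathcomp Require Import all_boot all_order all_algebra all_fingroup all_solvable.
From mathcomp.multinomials Require Import mpoly.
From mathcomp Require Import zify ring.

(* Every permutation of n+1 letters arises from one of n letters by inserting
   the maximal value: at the end it creates an ascent, at the front a descent,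
   in a descent gap an ascent, in an ascent gap a descent. Summing over all
   positions gives A_(n+1) = (s + t) A_n + s t D A_n.
   For the signed sums B = A^+ - A^- and n odd, the end contributes s B_n, the
   front - t B_n, and consecutive gaps have opposite signs. Conjugating by the
   reversal preserves the sign and the number of descents but mirrors the gaps,
   which exchanges gap parities when n is odd; so the inner insertions cancel
   and B_(n+1) = (s - t) B_n. The theorem is half the sum and half the
   difference of the two recurrences. *)

Set Implicit Arguments.
Unset Strict Implicit.
Unset Printing Implicit Defensive.

Import GRing.Theory Num.Theory.
Local Open Scope ring_scope.

(* Only meaningful for [g < n]: otherwise [inord] falls back to a junk
   position. *)
Definition descent n (p : 'S_n.+1) (g : nat) : bool :=
  (p (inord g.+1) < p (inord g))%N.

Definition weight n (p : 'S_n) : {mpoly rat[2]} :=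
  var_t ^+ des p * var_s ^+ asc p.

Definition signed_eulerian n : {mpoly rat[2]} :=
  \sum_(p : 'S_n) (-1) ^+ p * weight p.

(** * Descents and ascents counted gap by gap *)

Lemma des_sum n (p : 'S_n.+1) : des p = (\sum_(0 <= g < n) descent p g)%N.
Proof.
rewrite /des -sum1dep_card big_mkcond big_mkord big_ord_recr /=.
(* [des] ranges over all [n.+1] positions, but the last one has no successor and contributes
   nothing. *)
rewrite [X in (_ + X)%N](_ : _ = 0%N) ?addn0; last first.
  by case: existsP => // -[j /andP[/eqP jE _]];
    have := ltn_ord j; rewrite jE ltnn.
apply: eq_bigr => g _; rewrite /descent.
have -> : widen_ord (leqnSn n) g = inord g.
  by apply: val_inj; rewrite /= inordK // ltnW ?ltnS.
case: existsP => [[j /andP[/eqP jE ltj]]|noj].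
  suff -> : inord g.+1 = j by rewrite ltj.
  by apply: val_inj; rewrite /= inordK; have := ltn_ord g; lia.
case: ltnP => // lt_g; case: noj; exists (inord g.+1); rewrite lt_g andbT.
by rewrite !inordK // ?ltnS // ltnW.
Qed.

Lemma des_le n (p : 'S_n.+1) : (des p <= n)%N.
Proof.
rewrite des_sum -[leqRHS](subn0 n) -[leqRHS]muln1 -sum_nat_const_nat.
by apply: leq_sum => g _; case: descent.
Qed.

Lemma asc_sum n (p : 'S_n.+1) : asc p = (\sum_(0 <= g < n) ~~ descent p g)%N.
Proof.
rewrite /asc subn1 /= des_sum; apply/eqP.
rewrite -(eqn_add2l (\sum_(0 <= g < n) descent p g))
  subnKC -?des_sum ?des_le //.
rewrite des_sum -big_split /= (eq_bigr (fun=> 1%N)) => [|g _];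
  last by case: descent.
by rewrite sum_nat_const_nat muln1 subn0.
Qed.

(** * Effect of inserting the maximal value on descents and weights *)

Section InsertMax.
Variables (n : nat) (p : 'S_n.+1) (i : 'I_n.+2).
(** [q] sends [i] to the maximum and the remaining positions, in order, to the values of [p]: it is
    the word of [p] with a new largest letter inserted at position [i]. *)
Let q := lift_perm i ord_max p.

Lemma insert_max_lt g : (g < i)%N -> q (inord g) = p (inord g) :> nat.
Proof.
move=> lt_gi; have lt_gn : (g < n.+1)%N by have := ltn_ord i; lia.
have -> : inord g = lift i (inord g : 'I_n.+1).
  by apply: val_inj; rewrite /= !inordK // /bump; lia.
by rewrite lift_perm_lift lift_max.
Qed.

Lemma insert_max_gt g : (i <= g <= n)%N -> q (inord g.+1) = p (inord g) :> nat.
Proof.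
move=> /andP[le_ig le_gn].
have -> : inord g.+1 = lift i (inord g : 'I_n.+1).
  by apply: val_inj; rewrite /= !inordK // /bump; lia.
by rewrite lift_perm_lift lift_max.
Qed.

Lemma insert_max_eq g : g = i :> nat -> q (inord g) = n.+1 :> nat.
Proof. by move=> ->; rewrite inord_val lift_perm_id. Qed.

Lemma descent_insert_lt g : (g.+1 < i)%N -> descent q g = descent p g.
Proof. by move=> lt_gi; rewrite /descent !insert_max_lt // ltnW. Qed.

Lemma descent_insert_gt g : (i <= g < n)%N -> descent q g.+1 = descent p g.
Proof. by move=> gP; rewrite /descent !insert_max_gt //; lia. Qed.

Lemma descent_insert_before g : g.+1 = i -> descent q g = false.
Proof.
move=> gi; rewrite /descent (insert_max_eq gi) insert_max_lt ?gi //.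
by have := ltn_ord (p (inord g)); lia.
Qed.

Lemma descent_insert_at : (i <= n)%N -> descent q i = true.
Proof.
move=> le_in; rewrite /descent (insert_max_eq (erefl (i : nat))).
by rewrite insert_max_gt ?leqnn ?ltn_ord.
Qed.

Lemma des_insert_last : i = n.+1 :> nat -> des q = des p.
Proof.
move=> iE; rewrite !des_sum big_nat_recr //= descent_insert_before ?iE // addn0.
by apply: eq_big_nat => g gP; rewrite descent_insert_lt ?iE //; lia.
Qed.

Lemma des_insert_first : i = 0%N :> nat -> des q = (des p).+1.
Proof.
move=> iE; rewrite !des_sum big_nat_recl //= -iE descent_insert_at ?iE // add1n.
by congr _.+1; apply: eq_big_nat => g gP; rewrite descent_insert_gt ?iE.
Qed.

(** The gap [g] of [p] is replaced by two gaps of [q], an ascent at [g] and a descent at [g.+1]. So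
    a descent of [p] at [g] is merely moved, while an ascent there yields one more descent. *)
Lemma des_insert_inner g : i = g.+1 :> nat -> (g < n)%N ->
  des q = (des p + ~~ descent p g)%N.
Proof.
move=> iE lt_gn; rewrite !des_sum.
rewrite (@big_cat_nat _ _ _ g) /= //; last by lia.
rewrite [in RHS](@big_cat_nat _ _ _ g) /= //; last by lia.
rewrite (@big_ltn _ _ _ g n.+1); last by lia.
rewrite (@big_ltn _ _ _ g.+1 n.+1) // (@big_ltn _ _ _ g n) //.
rewrite descent_insert_before // -iE descent_insert_at; last by lia.
rewrite big_add1 /= iE.
rewrite (eq_big_nat _ _ (F2 := fun h => nat_of_bool (descent p h))) => [|h hP];
  last first.
  by rewrite descent_insert_lt; lia.
rewrite [X in (_ + (_ + (_ + X)))%N](eq_big_nat _ _ (F2 := fun h => nat_of_bool (descent p h))) => [|h hP];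
  last first.
  by rewrite descent_insert_gt; lia.
by case: descent => /=; lia.
Qed.

Lemma weight_insert_last : i = n.+1 :> nat -> weight q = var_s * weight p.
Proof.
move=> iE; have le_p := des_le p; rewrite /weight /asc des_insert_last //.
(* [asc] uses truncated subtraction; [des_le] makes this successor identity valid. *)
rewrite !subn1 /= (_ : n.+1 - des p = (n - des p).+1)%N; last by lia.
by rewrite exprS; ring.
Qed.

Lemma weight_insert_first : i = 0%N :> nat -> weight q = var_t * weight p.
Proof.
move=> iE; rewrite /weight /asc des_insert_first //.
by rewrite !subn1 /= subSS exprS mulrA.
Qed.

Lemma weight_insert_inner g : i = g.+1 :> nat -> (g < n)%N ->
  weight q = (if descent p g then var_s else var_t) * weight p.
Proof.
move=> iE lt_gn; have le_p := des_le p.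
rewrite /weight /asc (des_insert_inner iE lt_gn) !subn1 /=.
case: descent; rewrite /= ?addn0 ?addn1.
  by rewrite (_ : n.+1 - des p = (n - des p).+1)%N ?exprS; [ring | lia].
by rewrite subSS exprS mulrA.
Qed.

End InsertMax.

(** * Summation over all insertions *)

Lemma sum_lift_perm (V : nmodType) n (j : 'I_n.+1) (F : 'S_n.+1 -> V) :
  \sum_(p : 'S_n.+1) F p =
  \sum_(i : 'I_n.+1) \sum_(p : 'S_n) F (lift_perm i j p).
Proof.
pose h (u : 'I_n.+1 * 'S_n) := lift_perm u.1 j u.2.
have inj_h : injective h.
  move=> [i p] [i' p'] /= eq_h.
  (* The insertion position is recovered as the preimage of [j]. *)
  have eq_i : i = i'.
    apply: (@perm_inj _ (h (i, p))); rewrite {2}eq_h.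
    by rewrite /h !lift_perm_id.
  rewrite -{}eq_i in eq_h *; congr (_, _); apply/permP => k.
  apply: (@lift_inj _ j); rewrite -!(lift_perm_lift i).
  by move/permP/(_ (lift i k)): eq_h.
(* Injectivity suffices, as both sides have $(n+1)\cdot n! = (n+1)!$ elements. *)
have bij_h : bijective h.
  apply: inj_card_bij inj_h _.
  by rewrite card_prod card_ord !card_Sn factS.
by rewrite pair_big (reindex h) //; exact: onW_bij.
Qed.

(** The factors [c] (by position) and [d] (by permutation) are kept general to serve both
    recurrences: constants 1 for the unsigned one, signs for the signed one. *)
Lemma sum_weight_insert n (c : nat -> {mpoly rat[2]})
    (d : 'S_n.+1 -> {mpoly rat[2]}) :
  \sum_(i : 'I_n.+2) \sum_(p : 'S_n.+1)
      c i * d p * weight (lift_perm i ord_max p)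
  = (c n.+1 * var_s + c 0%N * var_t) * (\sum_p d p * weight p)
    + \sum_p d p * (\sum_(g < n) c g.+1
        * (if descent p g then var_s else var_t))
      * weight p.
Proof.
rewrite big_ord_recl big_ord_recr /=.
rewrite (eq_bigr (fun p => c 0%N * var_t * (d p * weight p))) => [|p _];
  last first.
  by rewrite weight_insert_first //; ring.
rewrite [X in _ + (_ + X)](eq_bigr (fun p => c n.+1 * var_s * (d p * weight p))) => [|p _];
  last first.
  by rewrite weight_insert_last //= mulrACA.
rewrite -!mulr_sumr exchange_big /=.
rewrite addrA addrAC -mulrDl [c 0%N * _ + _]addrC; congr (_ + _).
apply: eq_bigr => p _; rewrite mulr_sumr mulr_suml; apply: eq_bigr => g _ /=.
rewrite (weight_insert_inner _ (g := g)) //= /bump add1n.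
by rewrite mulrA [c _ * d p]mulrC !mulrA.
Qed.

(** * The operator D and the unsigned recurrence *)

Lemma mderiv_Xn (R : comNzRingType) n (i j : 'I_n) k :
  mderiv i ('X_j ^+ k : {mpoly R[n]}) = if i == j then 'X_j ^+ k.-1 *+ k else 0.
Proof.
elim: k => [|k IHk]; first by rewrite expr0 -mpolyC1 mderivC; case: ifP.
rewrite exprS mderivM IHk mderivX mnmE.
case: (eqVneq i j) => [->|_]; last by rewrite scale0r mul0r mulr0 addr0.
rewrite scale1r -[X in 'X_[X - _]]add0m addmK mpolyX0 mul1r.
case: k {IHk} => [|k] /=; first by rewrite mulr0n mulr0 addr0 expr0.
by rewrite mulrnAr -exprS -mulrS.
Qed.

(** Multiplying by $st$ restores the lowered exponents. The resulting factor has one $s$ per descent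
    and one $t$ per ascent, exactly the total of the inner insertions. *)
Lemma Dst_weight n (p : 'S_n) :
  var_s * var_t * Dst (weight p) =
  (var_s *+ des p + var_t *+ asc p) * weight p.
Proof.
rewrite /weight /Dst !mderivM !mderiv_Xn /= !mul0r !mulr0 add0r addr0.
set d := des p; set a := asc p.
(* For [k = 0] the exponent [k.-1] is a default value, harmless because the multiplicity is zero. *)
have XS (x : {mpoly rat[2]}) k : x * (x ^+ k.-1 *+ k) = x ^+ k *+ k.
  by case: k => [|k] /=; rewrite ?mulr0n ?mulr0 // mulrnAr -exprS.
rewrite mulrDr [X in X + _](_ : _ = var_t ^+ d * var_t * (var_s * (var_s ^+ a.-1 *+ a)));
  last by ring.
rewrite [X in _ + X](_ : _ = var_s ^+ a * var_s * (var_t * (var_t ^+ d.-1 *+ d)));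
  last by ring.
by rewrite !XS; ring.
Qed.

Lemma Dst_sum I (r : seq I) (P : pred I) (F : I -> {mpoly rat[2]}) :
  Dst (\sum_(i <- r | P i) F i) = \sum_(i <- r | P i) Dst (F i).
Proof. by rewrite /Dst !linear_sum -big_split. Qed.

Lemma eulerian_rec n :
  eulerian n.+2 = (var_s + var_t) * eulerian n.+1
                  + var_s * var_t * Dst (eulerian n.+1).
Proof.
rewrite {1}/eulerian (sum_lift_perm ord_max).
have := sum_weight_insert (fun=> 1) (fun _ : 'S_n.+1 => 1).
under eq_bigr => i _ do under eq_bigr => p _ do rewrite !mul1r.
rewrite /weight => ->.
rewrite !mul1r; congr (_ * _ + _).
  by apply: eq_bigr => p _; rewrite mul1r.
rewrite [Dst _]Dst_sum big_distrr; apply: eq_bigr => p _ /=.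
rewrite Dst_weight mul1r; congr (_ * _).
rewrite des_sum asc_sum !big_mkord -!sumrMnr -big_split;
    apply: eq_bigr => g _ /=.
by case: descent; rewrite /= mulr1n mulr0n ?addr0 ?add0r mul1r.
Qed.

(** * Reverse-complement symmetry and the signed recurrence *)

Definition revcomp n (p : 'S_n) : 'S_n :=
  (perm (@rev_ord_inj n) * p * perm (@rev_ord_inj n))%g.

Lemma revcompE n (p : 'S_n) i : revcomp p i = rev_ord (p (rev_ord i)).
Proof. by rewrite /revcomp !permM !permE. Qed.

Lemma revcompK n : involutive (@revcomp n).
Proof. by move=> p; apply/permP => i; rewrite !revcompE !rev_ordK. Qed.

Lemma odd_revcomp n (p : 'S_n) : odd_perm (revcomp p) = odd_perm p.
Proof. by rewrite /revcomp !odd_permM addbAC addbb. Qed.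

(** Positions [g], [g.+1] are mirrored to [n - g], [n - g.+1], which bound the gap [n - g.+1];
    reversing both positions and values keeps a descent a descent. *)
Lemma descent_revcomp n (p : 'S_n.+1) (g : 'I_n) :
  descent (revcomp p) g = descent p (rev_ord g).
Proof.
have lt_gn := ltn_ord g.
rewrite /descent !revcompE /=.
have -> : rev_ord (inord g.+1) = inord (n - g.+1) :> 'I_n.+1.
  by apply: val_inj; rewrite /= !inordK; lia.
have -> : rev_ord (inord g) = inord (n - g.+1).+1 :> 'I_n.+1.
  by apply: val_inj; rewrite /= !inordK; lia.
have := ltn_ord (p (inord (n - g.+1))).
by have := ltn_ord (p (inord (n - g.+1).+1)); lia.
Qed.

Lemma des_revcomp n (p : 'S_n.+1) : des (revcomp p) = des p.
Proof.
rewrite !des_sum !big_mkord (reindex_inj rev_ord_inj) /=.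
by apply: eq_bigr => g _; rewrite (descent_revcomp _ (rev_ord g)) rev_ordK.
Qed.

(** Here [n] counts gaps, one less than letters. As [n] is even, the mirrored gaps [g] and
    [n - g.+1] have opposite parity, so [revcomp] turns the sum into its negative. *)
Lemma signed_inner_eq0 n : ~~ odd n ->
  \sum_(p : 'S_n.+1) (-1) ^+ p *
     (\sum_(g < n) (-1) ^+ g
        * (if descent p g then var_s else var_t)) * weight p
  = 0.
Proof.
move=> n_even; set S := \sum_p _.
suff S_opp : S = - S.
  have : (2%:R : rat) *: S = 0 by rewrite scaler_nat mulr2n {1}S_opp addNr.
  by move/eqP; rewrite scaler_eq0 pnatr_eq0 => /eqP.
rewrite {1}/S (reindex_inj (inv_inj (@revcompK n.+1))) -sumrN.
apply: eq_bigr => p _; rewrite odd_revcomp /weight /asc des_revcomp.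
rewrite -mulNr -mulrN; congr (_ * _ * _).
rewrite (reindex_inj rev_ord_inj) -sumrN; apply: eq_bigr => g _.
rewrite (descent_revcomp _ (rev_ord g)) rev_ordK -mulNr; congr (_ * _).
rewrite -signr_odd -[in RHS]signr_odd /= oddB // (negbTE n_even) /=.
by case: odd; rewrite ?opprK.
Qed.

Lemma signed_eulerian_rec n : ~~ odd n ->
  signed_eulerian n.+2 = (var_s - var_t) * signed_eulerian n.+1.
Proof.
move=> n_even; rewrite {1}/signed_eulerian (sum_lift_perm ord_max).
(* Moving the maximum from position [i] to the end takes [n.+1 - i] adjacent transpositions, of the
   parity of [i.+1] since [n] is even. *)
pose c i : {mpoly rat[2]} := (-1) ^+ i.+1.
have signE (i : 'I_n.+2) (p : 'S_n.+1) :
    (-1) ^+ lift_perm i ord_max p = c i * (-1) ^+ p :> {mpoly rat[2]}.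
  rewrite odd_lift_perm /= n_even !signr_addb signr_odd /c exprS expr1.
  by rewrite [_ * -1]mulrC.
under eq_bigr => i _ do under eq_bigr => p _ do rewrite signE.
rewrite sum_weight_insert [X in _ + X](_ : _ = 0).
  rewrite addr0 /c expr1 -signr_odd /= negbK (negbTE n_even) expr0.
  by rewrite mul1r mulN1r.
rewrite -[RHS](signed_inner_eq0 n_even); apply: eq_bigr => p _.
congr (_ * _ * _); apply: eq_bigr => g _.
by rewrite /c !exprS !mulN1r opprK.
Qed.

(** * Separation into even and odd permutations *)

Lemma eulerian_split n : eulerian n = eulerian_even n + eulerian_odd n.
Proof. by rewrite /eulerian (bigID (fun p => p \in Alt 'I_n)). Qed.

Lemma signed_eulerian_split n :
  signed_eulerian n = eulerian_even n - eulerian_odd n.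
Proof.
rewrite /signed_eulerian (bigID (fun p => p \in Alt 'I_n)) /= -sumrN.
congr (_ + _); apply: eq_bigr => p; rewrite Alt_even.
  by move=> /negbTE->; rewrite mul1r.
by rewrite negbK => ->; rewrite mulN1r.
Qed.

Theorem theorem18 (m : nat) (m_gt0 : (0 < m)%N) :
  eulerian_even (2 * m) =
    var_s * eulerian_even (2 * m - 1) + var_t * eulerian_odd (2 * m - 1)
    + (2%:R^-1 : rat) *: (var_s * var_t * Dst (eulerian (2 * m - 1)))
  /\
  eulerian_odd (2 * m) =
    var_s * eulerian_odd (2 * m - 1) + var_t * eulerian_even (2 * m - 1)
    + (2%:R^-1 : rat) *: (var_s * var_t * Dst (eulerian (2 * m - 1))).
Proof.
case: m m_gt0 => // m _.
have -> : (2 * m.+1 - 1)%N = (2 * m).+1 by lia.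
have -> : (2 * m.+1)%N = (2 * m).+2 by lia.
have := eulerian_rec (2 * m).
have := @signed_eulerian_rec (2 * m); rewrite oddM /= => /(_ isT).
rewrite !signed_eulerian_split; set A := eulerian (2 * m).+1 => B_rec.
rewrite /A !eulerian_split -/A.
(* The derivative term is the same in both identities, so it becomes an atom for [ring]. *)
set DA := _ * Dst _; clearbody DA.
move: (eulerian_even (2 * m).+2) (eulerian_odd (2 * m).+2)
  B_rec => E O B_rec A_rec.
have inj2 : injective (fun f : {mpoly rat[2]} => (2%:R : rat) *: f).
  by apply: scalerI; rewrite pnatr_eq0.
have half (f : {mpoly rat[2]}) : (2%:R : rat) *: ((2%:R^-1 : rat) *: f) = f.
  by rewrite scalerA divff ?scale1r // pnatr_eq0.
split; apply: inj2; rewrite /= scalerDr half !scaler_nat.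
  rewrite (_ : E *+ 2 = (E + O) + (E - O)); last by ring.
  by rewrite A_rec B_rec; ring.
rewrite (_ : O *+ 2 = (E + O) - (E - O)); last by ring.
by rewrite A_rec B_rec; ring.
Qed.
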